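(* Any Lie affgebra structure on the Lie algebra $\mathbf{r}_3$ is isomorphic to one of the following pairwise non-isomorphic Lie affgebras, where $\beta_1,\beta_4,N_1$ denote complex parameters: $$\begin{array}{ll} F(\beta_1,\beta_4,N_1,0,0), & F(\beta_1,\beta_4,(\beta_1-\beta_4)(1-\beta_1),0,1),\\ F(\beta_1,\beta_1,0,1,0), & F(1,\beta_4,0,1,0)\ \text{ with } \beta_4\neq1.\end{array}$$
   Context: $\mathbf{r}_3$ is the complex Lie algebra with basis $e_1,e_2,e_3$ and $[e_1,e_2]=e_2$, $[e_1,e_3]=e_2+e_3$, $[e_2,e_3]=0$. For a complex Lie algebra $G$, linear maps $f,g:G\to G$ with $f([a,b])=[f(a),b]+[a,f(b)]-[a,g(b)]$ for all $a,b\in G$, and $s\in G$, the Lie affgebra $X(G;g,f,s)$ is the affine space $G$ (heap operation $\langle a,b,c\rangle=a-b+c$, action $(\alpha,a,b)=(1-\alpha)a+\alpha b$) with affine Lie bracket $\{x,y\}=[x,y]+g(x)+f(y-x)+s$. A Lie affgebra structure on $G$ is any such $X(G;g,f,s)$. An isomorphism of Lie affgebras is a bijective affine map $\varphi$ with $\varphi(\{x,y\})=\{\varphi(x),\varphi(y)\}$. $F(\beta_1,\beta_4,N_1,N_2,N_3)$ denotes $X(\mathbf{r}_3;g,f,s)$ with $f(e_1)=\beta_1e_1$, $f(e_2)=\beta_4e_2$, $f(e_3)=\beta_4e_3$, $g(e_i)=\beta_1e_i$ for $i=1,2,3$, and $s=N_1e_1+N_2e_2+N_3e_3$. *)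

(* Defs.v *)
From HB Require Import structures.
From mathcomp Require Import all_boot all_order all_algebra.
From mathcomp Require Import ring reals.
From mathcomp.real_closed Require Import complex.

Set Implicit Arguments.
Unset Strict Implicit.
Unset Printing Implicit Defensive.

Import GRing.Theory.
Local Open Scope ring_scope.

Record lieAlgebra (K : fieldType) := LieAlgebra {
  lie_sort :> lmodType K;
  lie : lie_sort -> lie_sort -> lie_sort;
  lie_linearl : forall y, linear (lie^~ y);
  lie_linearr : forall x, linear (lie x);
  lie_alt : forall x, lie x x = 0;
  lie_jacobi : forall x y z,
    lie x (lie y z) + lie y (lie z x) + lie z (lie x y) = 0
}.

Section Affine.
Variable K : fieldType.

Definition heap (V : lmodType K) (a b c : V) : V := a - b + c.

Definition act (V : lmodType K) (t : K) (a b : V) : V := (1 - t) *: a + t *: b.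

Definition affine_map (V W : lmodType K) (phi : V -> W) : Prop :=
  (forall a b c, phi (heap a b c) = heap (phi a) (phi b) (phi c)) /\
  (forall t a b, phi (act t a b) = act t (phi a) (phi b)).

End Affine.

(* The data (g, f, s) of X(G; g, f, s). *)
Record lieAffgebra (K : fieldType) (G : lieAlgebra K) := LieAffgebra {
  aff_g : {linear G -> G};
  aff_f : {linear G -> G};
  aff_s : G;
  aff_compat : forall a b : G,
    aff_f (lie a b) = lie (aff_f a) b + lie a (aff_f b) - lie a (aff_g b)
}.

Definition aff_lie (K : fieldType) (G : lieAlgebra K) (X : lieAffgebra G)
    (x y : G) : G :=
  lie x y + aff_g X x + aff_f X (y - x) + aff_s X.

Definition affgebra_iso (K : fieldType) (G H : lieAlgebra K)
    (X : lieAffgebra G) (Y : lieAffgebra H) : Prop :=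
  exists phi : G -> H,
    [/\ bijective phi, affine_map phi &
        forall x y, phi (aff_lie X x y) = aff_lie Y (phi x) (phi y)].

Section R3.
Variable K : fieldType.
Local Notation V := 'rV[K]_3.

Definition x1 (x : V) : K := x 0 (inord 0).
Definition x2 (x : V) : K := x 0 (inord 1).
Definition x3 (x : V) : K := x 0 (inord 2).

Definition e1 : V := delta_mx 0 (inord 0).
Definition e2 : V := delta_mx 0 (inord 1).
Definition e3 : V := delta_mx 0 (inord 2).

(* The linear extension of e1 |-> v1, e2 |-> v2, e3 |-> v3. *)
Definition lin3 (v1 v2 v3 x : V) : V := x1 x *: v1 + x2 x *: v2 + x3 x *: v3.

(* The alternating bilinear extension of
   (e1, e2) |-> v12, (e1, e3) |-> v13, (e2, e3) |-> v23. *)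
Definition alt3 (v12 v13 v23 x y : V) : V :=
  (x1 x * x2 y - x2 x * x1 y) *: v12 + (x1 x * x3 y - x3 x * x1 y) *: v13
  + (x2 x * x3 y - x3 x * x2 y) *: v23.

Definition r3_lie : V -> V -> V := alt3 e2 (e2 + e3) 0.

Let xD (x y : V) :
  (x1 (x + y) = x1 x + x1 y) * (x2 (x + y) = x2 x + x2 y)
  * (x3 (x + y) = x3 x + x3 y).
Proof. by rewrite /x1 /x2 /x3 !mxE. Qed.

Let xZ (a : K) (x : V) :
  (x1 (a *: x) = a * x1 x) * (x2 (a *: x) = a * x2 x)
  * (x3 (a *: x) = a * x3 x).
Proof. by rewrite /x1 /x2 /x3 !mxE. Qed.

Let xe :
  ((x1 e1 = 1) * (x2 e1 = 0) * (x3 e1 = 0))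
  * ((x1 e2 = 0) * (x2 e2 = 1) * (x3 e2 = 0))
  * ((x1 e3 = 0) * (x2 e3 = 0) * (x3 e3 = 1)).
Proof.
rewrite /x1 /x2 /x3 /e1 /e2 /e3 !mxE /=.
by do !split; rewrite -!val_eqE /= ?inordK.
Qed.

Let x0 : (x1 0 = 0) * (x2 0 = 0) * (x3 0 = 0).
Proof. by rewrite /x1 /x2 /x3 !mxE. Qed.

Lemma r3_ext (x y : V) : x1 x = x1 y -> x2 x = x2 y -> x3 x = x3 y -> x = y.
Proof.
move=> h1 h2 h3; apply/rowP => i.
have -> : i = inord i by rewrite inord_val.
by case: i => [[|[|[|//]]] ?].
Qed.

Definition coordE := (xD, xZ, xe, x0).

Lemma lin3_is_linear v1 v2 v3 : linear (lin3 v1 v2 v3).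
Proof.
by move=> a x y; apply: r3_ext; rewrite /lin3 !coordE; ring.
Qed.

HB.instance Definition _ v1 v2 v3 :=
  GRing.isLinear.Build K V V *:%R (lin3 v1 v2 v3) (lin3_is_linear v1 v2 v3).

Lemma lin3E v1 v2 v3 :
  [/\ lin3 v1 v2 v3 e1 = v1, lin3 v1 v2 v3 e2 = v2 & lin3 v1 v2 v3 e3 = v3].
Proof.
by split; rewrite /lin3 !coordE !(scale1r, scale0r) ?addr0 ?add0r.
Qed.

Lemma r3_lieE : [/\ r3_lie e1 e2 = e2, r3_lie e1 e3 = e2 + e3 & r3_lie e2 e3 = 0].
Proof. by split; apply: r3_ext; rewrite /r3_lie /alt3 !coordE; ring. Qed.

Lemma r3_linearl (y : V) : linear (r3_lie^~ y).
Proof. by move=> a x z; apply: r3_ext; rewrite /r3_lie /alt3 !coordE; ring. Qed.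

Lemma r3_linearr (x : V) : linear (r3_lie x).
Proof. by move=> a y z; apply: r3_ext; rewrite /r3_lie /alt3 !coordE; ring. Qed.

Lemma r3_alt (x : V) : r3_lie x x = 0.
Proof. by apply: r3_ext; rewrite /r3_lie /alt3 !coordE; ring. Qed.

Lemma r3_jacobi (x y z : V) :
  r3_lie x (r3_lie y z) + r3_lie y (r3_lie z x) + r3_lie z (r3_lie x y) = 0.
Proof. by apply: r3_ext; rewrite /r3_lie /alt3 !coordE; ring. Qed.

Definition r3 : lieAlgebra K :=
  LieAlgebra r3_linearl r3_linearr r3_alt r3_jacobi.

Section F.
Variables b1 b4 N1 N2 N3 : K.

Definition F_g : {linear r3 -> r3} := lin3 (b1 *: e1) (b1 *: e2) (b1 *: e3).
Definition F_f : {linear r3 -> r3} := lin3 (b1 *: e1) (b4 *: e2) (b4 *: e3).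
Definition F_s : r3 := N1 *: e1 + N2 *: e2 + N3 *: e3.

Lemma F_compat (a b : r3) :
  F_f (lie a b) = lie (F_f a) b + lie a (F_f b) - lie a (F_g b).
Proof.
rewrite -scaleN1r; apply: r3_ext;
  by rewrite /= /r3_lie /alt3 /lin3 !coordE; ring.
Qed.

Definition F : lieAffgebra r3 := LieAffgebra F_s F_compat.

End F.

(* Indices of the listed affgebras: a family together with its parameters. *)
Inductive r3_class :=
| Family1 (b1 b4 N1 : K)
| Family2 (b1 b4 : K)
| Family3 (b1 : K)
| Family4 (b4 : K) of b4 != 1.

Definition r3_affgebra (c : r3_class) : lieAffgebra r3 :=
  match c with
  | Family1 b1 b4 N1 => F b1 b4 N1 0 0
  | Family2 b1 b4 => F b1 b4 ((b1 - b4) * (1 - b1)) 0 1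
  | Family3 b1 => F b1 b1 0 1 0
  | Family4 b4 _ => F 1 b4 0 1 0
  end.

End R3.

(* Main.v *)
From HB Require Import structures.
Require Import Defs.
From mathcomp Require Import all_boot all_order all_algebra.
From mathcomp Require Import ring reals.
From mathcomp.real_closed Require Import complex.

(** Why the classification holds. Split an affine isomorphism as x |-> L x + t.
    Comparing constant and linear terms in x and y shows (affgebra_isoP) that it
    is an isomorphism exactly when L is a Lie algebra isomorphism that
    intertwines the maps g, carries f to f' + ad t, and satisfies
    L s + t = g' t + s'. So f matters only modulo inner derivations and the
    action of automorphisms.

    On r_3 put V = <e2, e3> and let M be the restriction of ad e1 to V, a
    unipotent Jordan block. The compatibility condition forces g to be a scalar
    b1 (aff_g_scalar) and f - b1 to be a derivation. In characteristic
    different from 2 a derivation maps r_3 into V and commutes with M on V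
    (aff_f_shape), so it is a multiple of the projection onto V along e1, up to
    an inner derivation. A translation therefore brings every structure to
    some F(b1, b4, N1, N2, N3) (exists_iso_F).

    The automorphisms of r_3 are the maps sending e1 to e1 + w with w in V and
    acting on V by an invertible matrix A commuting with M (r3_autP). An
    isomorphism between two F's with such a linear part must fix b1, b4 and N1,
    and its translation part is determined by M t = (b4 - b1) w. What is left
    is the action on n = N2 e2 + N3 e3, namely
      n |-> A n + N1 w + k M^-1 w,   k = (1 - b1) (b4 - b1)   (F_isoP).
    The operator N1 + k M^-1 has the single eigenvalue N1 + k. If N1 <> - k it
    is onto, and n can be moved to 0. If N1 = - k it is - k times the nilpotent
    map e3 |-> e2. Then N3 is zero or can be scaled to 1, with N2 removed by A;
    and when N3 = 0, N2 can be removed if k <> 0 and is zero or scaled to 1 if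
    k = 0. The equation k = 0 means b1 = b4 or b1 = 1, which gives the last two
    families. The same formula separates the families. *)

Set Implicit Arguments.
Unset Strict Implicit.
Unset Printing Implicit Defensive.

Import GRing.Theory Num.Theory.

Local Open Scope ring_scope.
Local Open Scope complex_scope.

(** * Consequences of compatibility in any Lie algebra *)

Section LieAlgebra.
Variables (K : fieldType) (G : lieAlgebra K).
Implicit Types x y z : G.

Lemma lieDl x y z : lie (x + y) z = lie x z + lie y z.
Proof. by have := lie_linearl z 1 x y; rewrite !scale1r. Qed.

Lemma lieDr x y z : lie x (y + z) = lie x y + lie x z.
Proof. by have := lie_linearr x 1 y z; rewrite !scale1r. Qed.

Lemma lie0x x : lie 0 x = 0.
Proof. by apply: (addrI (lie 0 x)); rewrite -lieDl !addr0. Qed.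

Lemma liex0 x : lie x 0 = 0.
Proof. by apply: (addrI (lie x 0)); rewrite -lieDr !addr0. Qed.

Lemma lieZr a x y : lie x (a *: y) = a *: lie x y.
Proof. by have := lie_linearr x a y 0; rewrite liex0 !addr0. Qed.

Lemma lieC x y : lie x y = - lie y x.
Proof.
apply/eqP; rewrite -addr_eq0; have := lie_alt (x + y).
by rewrite lieDl !lieDr !lie_alt add0r addr0 => ->.
Qed.

Lemma lie_oppr x y : lie x (- y) = lie y x.
Proof.
rewrite [RHS]lieC; apply: (addrI (lie x y)).
by rewrite -lieDr !subrr liex0.
Qed.

(** Take a = b in the compatibility condition: the terms in f cancel. *)
Lemma lie_aff_g (X : lieAffgebra G) x : lie x (aff_g X x) = 0.
Proof.
have := aff_compat X x x; rewrite lie_alt linear0 [lie (aff_f X x) x]lieC.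
by rewrite addNr sub0r => /esym/eqP; rewrite oppr_eq0 => /eqP.
Qed.

(** Polarization of [lie_aff_g]. *)
Lemma lie_aff_gC (X : lieAffgebra G) x y :
  lie (aff_g X x) y = lie x (aff_g X y).
Proof.
have := lie_aff_g X (x + y).
rewrite linearD lieDl !lieDr !lie_aff_g add0r addr0 [lie y _]lieC => /eqP.
by rewrite subr_eq0 => /eqP ->.
Qed.

End LieAlgebra.

(** * Isomorphisms of Lie affgebras in linear terms *)

Section Isomorphism.
Variables (K : fieldType).

Lemma affgebra_iso_trans (G1 G2 G3 : lieAlgebra K) (X : lieAffgebra G1)
    (Y : lieAffgebra G2) (Z : lieAffgebra G3) :
  affgebra_iso X Y -> affgebra_iso Y Z -> affgebra_iso X Z.
Proof.
move=> [p [bp [p1 p2] p3]] [q [bq [q1 q2] q3]]; exists (q \o p); split.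
- exact: bij_comp.
- by split=> * /=; rewrite ?(p1, p2, q1, q2).
- by move=> x y /=; rewrite p3 q3.
Qed.

Lemma affine_map_linear (V W : lmodType K) (phi : V -> W) :
  affine_map phi -> linear (fun x => phi x - phi 0).
Proof.
move=> [phi_heap phi_act] a x y.
have -> : a *: x + y = heap (act a 0 x) 0 y.
  by rewrite /heap /act scaler0 add0r subr0.
rewrite phi_heap phi_act /heap /act addrA; congr (_ + _ - _).
rewrite scalerBl scale1r scalerBr.
by rewrite -[phi 0 - _ + _]addrA [phi 0 + _]addrC addrK addrC.
Qed.

Lemma linear_affine_map (V W : lmodType K) (L : {linear V -> W}) (t : W) :
  affine_map (fun x => L x + t).
Proof.
split=> [a b c|a x y].
  rewrite !/heap linearD linearB opprD.
  rewrite [RHS](AC (2*2*2) ((1*3*5)*(2*4)*6)) /=.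
  by rewrite subrr addr0.
rewrite !/act linearD !linearZ /= !scalerDr addrACA -scalerDl subrK.
by rewrite scale1r.
Qed.

(** Moving the origin to t replaces f by f + ad t, because
    [t, y] + [x, t] = [t, y - x], and s by g t + s. *)
Lemma aff_lie_translate (G : lieAlgebra K) (X : lieAffgebra G) (t x y : G) :
  aff_lie X (x + t) (y + t) =
  lie x y + aff_g X x + (aff_f X (y - x) + lie t (y - x))
    + (aff_g X t + aff_s X).
Proof.
have -> : lie t (y - x) = lie x t + lie t y.
  by rewrite lieDr lie_oppr addrC.
rewrite /aff_lie lieDl !lieDr lie_alt addr0.
rewrite opprD [y + t + _]addrACA subrr addr0 [aff_g X _]linearD.
by rewrite [LHS](AC (3*2*1*1) ((1*4*(6*(2*3)))*(5*7))) /=.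
Qed.

(** The parts of the bracket identity can be separated: x = y = 0
    gives the condition on s, x = 0 the one on f, and x = y the one on g. What
    remains is multiplicativity of the linear part. *)
Lemma affgebra_isoP (G H : lieAlgebra K) (X : lieAffgebra G)
    (Y : lieAffgebra H) :
  affgebra_iso X Y <->
  exists (L : {linear G -> H}) (t : H),
    [/\ bijective L,
        forall x y, L (lie x y) = lie (L x) (L y),
        forall x, L (aff_g X x) = aff_g Y (L x),
        forall x, L (aff_f X x) = aff_f Y (L x) + lie t (L x) &
        L (aff_s X) + t = aff_g Y t + aff_s Y].
Proof.
split=> [[phi [bphi aphi hphi]]|[L [t [bL hL hg hf hs]]]]; last first.
  exists (fun x => L x + t); split; last 1 first.
  - move=> x y; rewrite aff_lie_translate /aff_lie linearD -addrA hs.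
    by rewrite 2!linearD hL hg hf linearB.
  - case: bL => M K1 K2; exists (fun y => M (y - t)) => x.
      by rewrite addrK K1.
    by rewrite K2 subrK.
  - exact: linear_affine_map.
have [L phiE] : exists L : {linear G -> H}, forall x, phi x = L x + phi 0.
  pose Lb := GRing.isLinear.Build K G H *:%R _ (affine_map_linear aphi).
  pose L : {linear G -> H} := HB.pack (fun x => phi x - phi 0) Lb.
  by exists L => x; rewrite /= subrK.
exists L, (phi 0); move: (phi 0) phiE => t phiE.
have hs : L (aff_s X) + t = aff_g Y t + aff_s Y.
  have := hphi 0 0; rewrite !phiE aff_lie_translate /aff_lie !subrr.
  by rewrite !(linear0, lie0x, liex0) !(add0r, addr0).
have {}hphi x y : L (lie x y) + L (aff_g X x) + L (aff_f X (y - x))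
    = lie (L x) (L y) + aff_g Y (L x) + (aff_f Y (L (y - x))
      + lie t (L (y - x))).
  apply: (addIr (aff_g Y t + aff_s Y)); rewrite -{1}hs addrA -!linearD -phiE.
  by rewrite hphi !phiE aff_lie_translate -linearB.
have hf x : L (aff_f X x) = aff_f Y (L x) + lie t (L x).
  by have := hphi 0 x; rewrite subr0 !(linear0, lie0x, add0r).
have hg x : L (aff_g X x) = aff_g Y (L x).
  have := hphi x x; rewrite subrr !lie_alt !linear0 liex0.
  by rewrite !addr0 !add0r.
split=> //.
  case: bphi => psi K1 K2; exists (fun y => psi (y + t)) => x.
    by rewrite -phiE K1.
  by apply: (addIr t); rewrite -phiE K2.
by move=> x y; have := hphi x y; rewrite hf hg => /addIr/addIr.
Qed.

End Isomorphism.

(** * Coordinates on r_3 *)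

Section R3.
Variable K : fieldType.
Implicit Types (a b c d u v : K) (x y : r3 K).

Lemma coordN x : (x1 (- x) = - x1 x) * (x2 (- x) = - x2 x) * (x3 (- x) = - x3 x).
Proof. by rewrite /x1 /x2 /x3 !mxE. Qed.

Lemma coord_lie x y :
  (x1 (lie x y) = 0) *
  (x2 (lie x y) = x1 x * (x2 y + x3 y) - (x2 x + x3 x) * x1 y) *
  (x3 (lie x y) = x1 x * x3 y - x3 x * x1 y).
Proof. by do !split; rewrite /= /r3_lie /alt3 !coordE; ring. Qed.

Lemma coord_lin3 (v1 v2 v3 x : 'rV[K]_3) :
  (x1 (lin3 v1 v2 v3 x) = x1 x * x1 v1 + x2 x * x1 v2 + x3 x * x1 v3) *
  (x2 (lin3 v1 v2 v3 x) = x1 x * x2 v1 + x2 x * x2 v2 + x3 x * x2 v3) *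
  (x3 (lin3 v1 v2 v3 x) = x1 x * x3 v1 + x2 x * x3 v2 + x3 x * x3 v3).
Proof. by rewrite /lin3 !coordE. Qed.

Lemma coord_aff_F b1 b4 N1 N2 N3 :
  let X := F b1 b4 N1 N2 N3 in
  [/\ forall x, aff_g X x = b1 *: x,
      forall x, (x1 (aff_f X x) = b1 * x1 x) * (x2 (aff_f X x) = b4 * x2 x) *
        (x3 (aff_f X x) = b4 * x3 x) &
      (x1 (aff_s X) = N1) * (x2 (aff_s X) = N2) * (x3 (aff_s X) = N3)].
Proof.
split=> [x|x|]; first by apply: r3_ext; rewrite /= coord_lin3 !coordE; ring.
  by do !split; rewrite /= coord_lin3 !coordE; ring.
by do !split; rewrite /= /F_s !coordE; ring.
Qed.

Lemma linear_lin3 (h : {linear r3 K -> r3 K}) x :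
  h x = lin3 (h (e1 K)) (h (e2 K)) (h (e3 K)) x.
Proof.
have {1}-> : x = x1 x *: e1 K + x2 x *: e2 K + x3 x *: e3 K.
  by apply: r3_ext; rewrite !coordE; ring.
by rewrite /lin3 !linearD !linearZ.
Qed.

Lemma lie_e1_e2 : @lie _ (r3 K) (e1 K) (e2 K) = e2 K.
Proof. by case: (r3_lieE K). Qed.

Lemma lie_e1_e3 : @lie _ (r3 K) (e1 K) (e3 K) = e2 K + e3 K.
Proof. by case: (r3_lieE K). Qed.

Definition simpr :=
  (mulr0, mul0r, mulr1, mul1r, addr0, add0r, subr0, sub0r, subrr).

Lemma coord_inj x y : x = y -> [/\ x1 x = x1 y, x2 x = x2 y & x3 x = x3 y].
Proof. by move=> ->. Qed.

Lemma coord_injD x y z : x = y + z ->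
  [/\ x1 x = x1 y + x1 z, x2 x = x2 y + x2 z & x3 x = x3 y + x3 z].
Proof. by move=> ->; rewrite !coordE. Qed.

(** Reduces a linear equation that follows from another one to a ring identity. *)
Lemma eq_sub_eq a b c d : c = d -> a - b = c - d -> a = b.
Proof. by move=> -> /eqP; rewrite subrr subr_eq0 => /eqP. Qed.

(** * The maps g and f of a structure on r_3 *)

(** The identity [g e1, v] = [e1, g v] carries the scalar by which g acts on e1
    to all of V, since ad e1 is injective there. *)
Lemma aff_g_scalar (X : lieAffgebra (r3 K)) :
  exists b1, forall x, aff_g X x = b1 *: x.
Proof.
have := linear_lin3 (aff_g X).
have [] := coord_inj (lie_aff_g X (e1 K)).
have [] := coord_inj (lie_aff_g X (e2 K)).
have [] := coord_inj (lie_aff_g X (e3 K)).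
have [] := coord_inj (lie_aff_gC X (e1 K) (e2 K)).
have [] := coord_inj (lie_aff_gC X (e1 K) (e3 K)).
move: (aff_g X (e1 K)) (aff_g X (e2 K)) (aff_g X (e3 K)) => g1 g2 g3.
rewrite !coord_lie !coordE !simpr => _ E1 E2 _ E3 E4 _ _ E5 _ E6 _ _ E7 E8 gE.
move: E1 E3 E7; rewrite -E4 -E2 E8 !addr0 => E1 E3 E7.
move: E1; rewrite addrC -[LHS]addr0 => /addrI E1.
move/eqP: E5; rewrite oppr_eq0 => /eqP E5.
move/eqP: E6; rewrite oppr_eq0 => /eqP E6.
exists (x1 g1) => x; rewrite gE.
apply: r3_ext; rewrite coord_lin3 coordE.
- by rewrite E5 E6; ring.
- by rewrite -E1 -E3 E7; ring.
- by rewrite -E2 -E4 E8; ring.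
Qed.

(** Let D = f - b1, a derivation, and let l be the e1-coordinate of D e1. D
    preserves V, and applying D to [e1, v] = M v gives D M - M D = l M on V.
    Taking traces yields 2 l = 0, so l = 0 and D commutes with the Jordan block
    M; hence it is upper triangular on V with equal diagonal entries. *)
Lemma aff_f_shape (X : lieAffgebra (r3 K)) b1 :
    (2%:R : K) != 0 -> (forall x, aff_g X x = b1 *: x) ->
  exists b4 p q d, forall x,
    (x1 (aff_f X x) = b1 * x1 x) *
    (x2 (aff_f X x) = p * x1 x + b4 * x2 x + d * x3 x) *
    (x3 (aff_f X x) = q * x1 x + b4 * x3 x).
Proof.
move=> K2 gE; have := linear_lin3 (aff_f X).
have compat x y : aff_f X (lie x y) + b1 *: lie x y
    = lie (aff_f X x) y + lie x (aff_f X y).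
  by rewrite aff_compat gE lieZr subrK.
have [] := coord_injD (compat (e1 K) (e2 K)).
have [] := coord_injD (compat (e1 K) (e3 K)).
rewrite lie_e1_e2 lie_e1_e3 linearD.
move: (aff_f X (e1 K)) (aff_f X (e2 K)) (aff_f X (e3 K)) => f1 f2 f3.
rewrite !coord_lie !coordE !simpr => E1 E2 E3 E4 E5 _ fE.
move: E1 E2 E3; rewrite E4 add0r => E1 E2 E3.
(* F23 says that the lower-left entry of D on V is l = x1 f1 - b1; the
   e2-coordinate E5 says that it is also - l. *)
have F23 : x3 f2 = x1 f1 - b1 by apply: (eq_sub_eq E3); ring.
have F11 : x1 f1 = b1.
  by apply: (mulfI K2); apply: (eq_sub_eq (esym E5)); rewrite F23; ring.
rewrite F11 subrr in F23.
have F33 : x3 f3 = x2 f2.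
  by apply: (eq_sub_eq (esym E2)); rewrite F11; ring.
exists (x2 f2), (x2 f1), (x3 f1), (x2 f3) => x; rewrite fE.
do !split; rewrite coord_lin3.
- by rewrite F11 E4 E1; ring.
- by ring.
- by rewrite F23 F33; ring.
Qed.

(** * Automorphisms of r_3 *)

(** The map e1 |-> e1 + u e2 + v e3, e2 |-> a e2, e3 |-> b e2 + a e3, described by
    its coordinates so that it can be used for an arbitrary L. *)
Definition r3_aut_coord (L : r3 K -> r3 K) a b u v :=
  forall x, (x1 (L x) = x1 x) *
            (x2 (L x) = x1 x * u + x2 x * a + x3 x * b) *
            (x3 (L x) = x1 x * v + x3 x * a).

Lemma r3_aut_exists a b u v : a != 0 ->
  exists L : {linear r3 K -> r3 K},
    [/\ bijective L, forall x y, L (lie x y) = lie (L x) (L y) &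
        r3_aut_coord L a b u v].
Proof.
move=> a0.
have lin a' b' u' v' : exists L : {linear r3 K -> r3 K},
    r3_aut_coord L a' b' u' v'.
  exists (lin3 (e1 K + u' *: e2 K + v' *: e3 K) (a' *: e2 K)
               (b' *: e2 K + a' *: e3 K)) => x.
  by do !split; rewrite /= coord_lin3 !coordE; ring.
have [L LE] := lin a b u v.
(* The inverse: invert the block a + b E12 on V, then solve for the image of e1. *)
pose v' := - v / a.
have [M ME] := lin a^-1 (- b / a ^+ 2) (- (u + v' * b) / a) v'.
exists L; split=> // [|x y].
  exists M => x; apply: r3_ext; rewrite ?(LE, ME) ?(LE, ME) /v' //; by field.
by apply: r3_ext; rewrite !(LE, coord_lie) ?LE; ring.
Qed.

(** L preserves V = [r_3, r_3] and satisfies L M = c M L on V, where c is the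
    e1-coordinate of L e1. As L e2 <> 0 is an eigenvector of c M for the
    eigenvalue 1 and M is unipotent, c = 1; so L commutes with M on V. *)
Lemma r3_autP (L : {linear r3 K -> r3 K}) :
    injective L -> (forall x y, L (lie x y) = lie (L x) (L y)) ->
  exists a b u v, a != 0 /\ r3_aut_coord L a b u v.
Proof.
move=> injL homL; have := linear_lin3 L.
have [] := coord_inj (homL (e1 K) (e2 K)).
have [] := coord_inj (homL (e1 K) (e3 K)).
have : L (e2 K) <> 0.
  rewrite -[X in _ <> X](linear0 L) => /injL/coord_inj[_].
  by rewrite !coordE => /eqP; rewrite oner_eq0.
rewrite lie_e1_e2 lie_e1_e3 linearD.
move: (L (e1 K)) (L (e2 K)) (L (e3 K)) => l1 l2 l3 l2_neq0.
rewrite !coord_lie !coordE => E1 E2 E3 E4.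
move: E1 E2 E3; rewrite E4 add0r => E1; rewrite E1 !simpr => E2 E3 E5 E6 LE.
have L23 : x3 l2 = 0.
  apply/eqP; apply: contraT => c0; have L11 : x1 l1 = 1.
    by apply: (mulIf c0); rewrite mul1r -E6.
  by case/eqP: c0; apply: (eq_sub_eq (esym E5)); rewrite L11; ring.
have a0 : x2 l2 != 0.
  by apply/eqP => L22; apply: l2_neq0; apply: r3_ext; rewrite coordE.
have L11 : x1 l1 = 1 by apply: (mulIf a0); rewrite mul1r {2}E5 L23 addr0.
have L33 : x3 l3 = x2 l2.
  by apply: (eq_sub_eq (esym E2)); rewrite L11; ring.
exists (x2 l2), (x2 l3), (x2 l1), (x3 l1); split=> // x; rewrite LE.
do !split; rewrite coord_lin3.
- by rewrite L11 E1 E4; ring.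
- by ring.
- by rewrite L23 L33; ring.
Qed.

(** * Isomorphisms between the affgebras F *)

(** With w = u e2 + v e3, the equation L f = (f' + ad t) L on V says
    b4 - b4' = t1 M, so t1 = 0 and b4 = b4'; on e1 it says M t = (b4 - b1) w,
    that is t = (b4 - b1) ((u - v) e2 + v e3). Substituting this in
    L s + t = g' t + s' gives the formulas for N2' and N3'. *)
Lemma F_isoP b1 b4 N1 N2 N3 b1' b4' N1' N2' N3' :
  let k := (1 - b1) * (b4 - b1) in
  affgebra_iso (F b1 b4 N1 N2 N3) (F b1' b4' N1' N2' N3') <->
  [/\ b1' = b1, b4' = b4, N1' = N1 &
      exists a b u v, [/\ a != 0,
        N2' = (N1 + k) * u - k * v + a * N2 + b * N3 &
        N3' = (N1 + k) * v + a * N3]].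
Proof.
move=> k.
have [] := coord_aff_F b1 b4 N1 N2 N3.
have [] := coord_aff_F b1' b4' N1' N2' N3'.
move: (F b1 b4 N1 N2 N3) (F b1' b4' N1' N2' N3') => X Y gY fY sY gX fX sX.
rewrite affgebra_isoP; split.
  case=> L [t [/bij_inj injL homL gL fL sL]].
  have [a [b [u [v [a0 LE]]]]] := r3_autP injL homL.
  have [] := coord_inj (gL (e1 K)).
  have [] := coord_injD (fL (e1 K)).
  have [] := coord_injD (fL (e2 K)).
  have [] := coord_injD (fL (e3 K)).
  have [] := coord_inj sL.
  rewrite !gX !gY.
  rewrite !coord_lie !LE !fX !fY !coordE !LE !sX !sY !coordE !simpr.
  move=> s1 s2 s3 _ f32 _ _ f22 _ _ f12 f13 g11 _ _.
  have {f22} b4E : b4 = b4' + x1 t by apply: (mulIf a0); rewrite f22; ring.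
  have t1 : x1 t = 0.
    by apply: (mulIf a0); apply: (eq_sub_eq (esym f32)); rewrite b4E; ring.
  move: s1 f12 f13 s2 s3; rewrite -g11 b4E t1 !simpr => <- f12 f13 s2 s3.
  have t3 : x3 t = (b4' - b1) * v by apply: (eq_sub_eq f13); ring.
  have t2 : x2 t = (b4' - b1) * (u - v).
    by apply: (eq_sub_eq f12); rewrite t3; ring.
  split=> //; exists a, b, u, v; split=> //.
    by apply: (eq_sub_eq (esym s2)); rewrite /k t2 b4E t1; ring.
  by apply: (eq_sub_eq (esym s3)); rewrite /k t3 b4E t1; ring.
case=> eb1 eb4 eN1 [a [b [u [v [a0 eN2 eN3]]]]]; subst b1' b4' N1' N2' N3'.
have [L [bijL homL LE]] := r3_aut_exists b u v a0.
exists L, ((b4 - b1) *: ((u - v) *: e2 K + v *: e3 K)); split=> // [x|x|].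
- by rewrite gX gY linearZ.
- by apply: r3_ext; rewrite LE !fX coordE fY coord_lie !LE ?coordE; ring.
- by rewrite gY; apply: r3_ext; rewrite !coordE LE !sX !sY /k; ring.
Qed.

(** A translation suffices. With f as in [aff_f_shape], adding the inner derivation
    given by the e1-component d of t removes the nilpotent part d of f on V, at
    the cost of replacing b4 by b4 - d; the V-component of t solves
    M t = - (p e2 + q e3) and removes the V-component of f e1. *)
Lemma exists_iso_F (X : lieAffgebra (r3 K)) : (2%:R : K) != 0 ->
  exists b1 b4 N1 N2 N3, affgebra_iso X (F b1 b4 N1 N2 N3).
Proof.
move=> K2; have [b1 gE] := aff_g_scalar X.
have [b4 [p [q [d fE]]]] := aff_f_shape K2 gE.
pose t : r3 K := d *: e1 K + (q - p) *: e2 K - q *: e3 K.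
have tE : (x1 t = d) * (x2 t = q - p) * (x3 t = - q).
  by do !split; rewrite /t !coordE coordN !coordE; ring.
move: t tE => t tE; pose s := aff_s X + (1 - b1) *: t.
exists b1, (b4 - d), (x1 s), (x2 s), (x3 s).
have [] := coord_aff_F b1 (b4 - d) (x1 s) (x2 s) (x3 s).
move: (F _ _ _ _ _) => Y gY fY sY; apply/affgebra_isoP.
exists idfun, t; split=> //= [|x|x|].
- by exists id.
- by rewrite gE gY.
- by apply: r3_ext; rewrite fE coordE fY coord_lie ?tE; ring.
- by rewrite gY; apply: r3_ext; rewrite !coordE sY /s !coordE; ring.
Qed.

(** * Classification *)

Lemma F_normal_form b1 b4 N1 N2 N3 :
  exists i : r3_class K, affgebra_iso (F b1 b4 N1 N2 N3) (r3_affgebra i).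
Proof.
pose k := (1 - b1) * (b4 - b1).
(* N1 + k is the eigenvalue of w |-> N1 w + k M^-1 w; off zero, w kills n. *)
have [N1E|N1k] := eqVneq (N1 + k) 0; last first.
  pose v := - N3 / (N1 + k).
  exists (Family1 b1 b4 N1); apply/F_isoP; split=> //.
  exists 1, 0, ((k * v - N2) / (N1 + k)), v; rewrite oner_neq0 -/k /v.
  by split=> //; field.
have {N1E} N1E : N1 = - k by apply/eqP; rewrite -addr_eq0 N1E.
have [N3E|N30] := eqVneq N3 0; last first.
  exists (Family2 b1 b4); apply/F_isoP; split=> //; first by rewrite N1E /k; ring.
  (* The block sends n to e3. *)
  exists N3^-1, (- N2 / N3 ^+ 2), 0, 0; rewrite invr_eq0; split=> //; field=> //.
(* Here N1 w + k M^-1 w = - k v e2, which removes N2 unless k = 0. *)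
rewrite {}N3E; have [kE|k0] := eqVneq k 0; last first.
  exists (Family1 b1 b4 N1); apply/F_isoP; split=> //.
  exists 1, 0, 0, (N2 / k); rewrite oner_neq0 N1E -/k.
  by split=> //; field.
have {N1E} N1E : N1 = 0 by rewrite N1E kE oppr0.
have [N2E|N20] := eqVneq N2 0.
  exists (Family1 b1 b4 N1); apply/F_isoP; split=> //.
  by exists 1, 0, 0, 0; rewrite oner_neq0 N2E; split=> //; ring.
have [b4E|b41] := eqVneq b4 b1.
  exists (Family3 b1); apply/F_isoP; split=> //.
  exists N2^-1, 0, 0, 0; rewrite invr_eq0; split=> //; by field.
have b1E : b1 = 1.
  move/eqP: kE; rewrite mulf_eq0 subr_eq0 [b4 - _ == 0]subr_eq0 (negPf b41) orbF.
  by move/eqP.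
rewrite b1E in b41 *; exists (Family4 b41); apply/F_isoP; split=> //.
exists N2^-1, 0, 0, 0; rewrite invr_eq0; split=> //; by field.
Qed.

(** By [F_isoP] b1, b4 and N1 agree, which leaves only pairs of families that can
    share these parameters. Between distinct families either N1 + k = 0 and n
    would be moved between 0 and a nonzero vector or have N3 change between 0
    and a nonzero value, or the parameters of the third and fourth families
    contradict b4 <> 1. *)
Lemma r3_class_inj (i j : r3_class K) :
  affgebra_iso (r3_affgebra i) (r3_affgebra j) -> i = j.
Proof.
have one_neq0 : (1 : K) = 0 -> False by move/eqP; rewrite oner_eq0.
case: i => [b1 b4 N1|b1 b4|b1|b4 b4_1];
  case: j => [b1' b4' N1'|b1' b4'|b1'|b4' b4_1'] /=;
  case/F_isoP => e1 e4 eN [a [b [u [v [/eqP a0 E2 E3]]]]]; subst => //.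
- by case: one_neq0; rewrite E3; ring.
- by case: one_neq0; rewrite E2; ring.
- by case: one_neq0; rewrite E2; ring.
- by case: a0; apply: (eq_sub_eq (esym E3)); ring.
- by case: a0; apply: (eq_sub_eq (esym E3)); ring.
- by case: a0; apply: (eq_sub_eq (esym E3)); ring.
- by case: a0; apply: (eq_sub_eq (esym E2)); ring.
- by case: one_neq0; rewrite E3; ring.
- by have := b4_1'; rewrite eqxx.
- by case: a0; apply: (eq_sub_eq (esym E2)); ring.
- by case: one_neq0; rewrite E3; ring.
- by have := b4_1; rewrite eqxx.
- by congr Family4; apply: bool_irrelevance.
Qed.

End R3.

Theorem theorem3p3 (R : realType) :
  (forall X : lieAffgebra (r3 R[i]),
     exists c : r3_class R[i], affgebra_iso X (r3_affgebra c)) /\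
  (forall c c' : r3_class R[i],
     affgebra_iso (r3_affgebra c) (r3_affgebra c') -> c = c').
Proof.
split=> [X|]; last exact: r3_class_inj.
have [|b1 [b4 [N1 [N2 [N3 isoX]]]]] := exists_iso_F X; first by rewrite pnatr_eq0.
have [c isoF] := F_normal_form b1 b4 N1 N2 N3.
by exists c; apply: affgebra_iso_trans isoX isoF.
Qed.
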